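(* The following sets are subsoluble: 1. for any $\alpha,\beta,\gamma\in\mathbb{R}$ and any integers $i,j\ge 0$, the set of all points of $\mathbb{R}^{i+j+1}$ obtained by permuting the coordinates of $(\underbrace{\alpha,\ldots,\alpha}_{i},\underbrace{\beta,\ldots,\beta}_{j},\gamma)$; 2. the vertex set of every regular polytope, except for possibly the 120-cell and the 600-cell; 3. the set of four vertices of every isosceles trapezium.
   Context: Group actions on a finite set $X\subset\mathbb{R}^d$ are by isometries, i.e. every group element acts as a distance-preserving bijection of $X$. A finite set $X\subset\mathbb{R}^d$ is called soluble if there is a soluble (solvable) group that acts transitively on $X$. A finite set $X\subset\mathbb{R}^d$ is called subsoluble if there is a soluble set $Y\subset\mathbb{R}^{n}$, for some $n$ (possibly larger than $d$), containing an isometric copy of $X$. Regular polytopes are the convex regular polytopes in dimension at least 2: regular polygons; the five Platonic solids; the six convex regular 4-polytopes (5-cell, 8-cell, 16-cell, 24-cell, 120-cell with Schläfli symbol $\{5,3,3\}$, 600-cell with Schläfli symbol $\{3,3,5\}$); and, in each dimension $d\ge 5$, the regular $d$-simplex, the $d$-cube and the $d$-orthoplex (cross-polytope). An isosceles trapezium (isosceles trapezoid) is a (simple, planar, non-degenerate) quadrilateral with one pair of parallel sides and the other pair of sides equal in length; parallelograms that are not rectangles are excluded. *)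

(* Defs.v *)
From HB Require Import structures.
From mathcomp Require Import all_boot all_order all_algebra all_fingroup all_solvable.
From mathcomp Require Import finmap.
From mathcomp Require Import classical_sets reals trigo.

Set Implicit Arguments.
Unset Strict Implicit.
Unset Printing Implicit Defensive.

Import Order.TTheory GRing.Theory Num.Theory.

Local Open Scope fset_scope.
Local Open Scope ring_scope.

(* The norm that MathComp-Analysis puts on 'rV[R]_n is the sup norm, hence
   these Euclidean versions. *)
Definition dotp (R : realType) n (x y : 'rV[R]_n) : R :=
  \sum_(i < n) x 0 i * y 0 i.

Definition dist (R : realType) n (x y : 'rV[R]_n) : R :=
  Num.sqrt (dotp (x - y) (x - y)).

(* Finite groups lose no generality: a group acting on the finite set X acts
   through its image in the symmetric group of X, which is soluble if the
   group is. *)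
Definition soluble (R : realType) n (X : {fset 'rV[R]_n}) : Prop :=
  exists (gT : finGroupType) (G : {group gT}) (to : action G X),
    [/\ solvable G,
        forall g, g \in G -> forall x y : X,
          dist (val (to x g)) (val (to y g)) = dist (val x) (val y)
      & [transitive G, on [set: X] | to]].

Definition subsoluble (R : realType) d (X : {fset 'rV[R]_d}) : Prop :=
  exists (n : nat) (Y : {fset 'rV[R]_n}) (f : 'rV[R]_d -> 'rV[R]_n),
    [/\ soluble Y,
        forall x, x \in X -> f x \in Y
      & forall x y, x \in X -> y \in X -> dist (f x) (f y) = dist x y].

Definition coord_perms (R : realType) n (v : 'rV[R]_n) : {fset 'rV[R]_n} :=
  [fset col_perm s v | s : 'S_n in predT].

Variant regular_polytope : Type :=
| RegularPolygon (k : nat) of (3 <= k)%N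
| Simplex (d : nat) of (3 <= d)%N
| Cube (d : nat) of (3 <= d)%N
| Orthoplex (d : nat) of (3 <= d)%N
| Dodecahedron
| Icosahedron
| Cell24
| Cell120
| Cell600.

(* The model of the d-simplex is the standard one in R^(d+1). *)
Definition model_dim (P : regular_polytope) : nat :=
  match P with
  | RegularPolygon _ _ => 2
  | Simplex d _ => d.+1
  | Cube d _ => d
  | Orthoplex d _ => d
  | Dodecahedron => 3
  | Icosahedron => 3
  | Cell24 => 4
  | Cell120 => 4
  | Cell600 => 4
  end.

Section Models.
Variable R : realType.

Definition golden : R := (1 + Num.sqrt 5) / 2.
Local Notation phi := golden.

Definition row_of_seq n (s : seq R) : 'rV[R]_n := \row_i s`_i.

Definition signed_perms n (A : {set 'S_n}) (s : seq R) : {fset 'rV[R]_n} :=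
  [fset \row_i ((-1) ^+ e i * row_of_seq n s 0 (p i))
     | p : 'S_n in A, e : {ffun 'I_n -> bool} in predT].

Definition all_signed_perms n := signed_perms [set: 'S_n].

Definition even_signed_perms n := signed_perms [set p : 'S_n | ~~ odd_perm p].

Definition polygon_vertices (k : nat) : {fset 'rV[R]_2} :=
  [fset row_of_seq 2 [:: cos (2 * pi * (i : nat)%:R / k%:R);
                         sin (2 * pi * (i : nat)%:R / k%:R)]
     | i : 'I_k in predT].

Definition simplex_vertices (d : nat) : {fset 'rV[R]_d.+1} :=
  [fset delta_mx 0 i | i : 'I_d.+1 in predT].

Definition cube_vertices (d : nat) : {fset 'rV[R]_d} :=
  [fset \row_i (-1) ^+ e i | e : {ffun 'I_d -> bool} in predT].

Definition orthoplex_vertices (d : nat) : {fset 'rV[R]_d} :=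
  [fset (-1) ^+ b *: delta_mx 0 i | i : 'I_d in predT, b : bool in predT].

(* Standard centred coordinates, up to scale, of the exceptional polytopes: the
   3-cycles of coordinates usual in dimension 3 are the even permutations. *)
Definition dodecahedron_vertices : {fset 'rV[R]_3} :=
  all_signed_perms 3 [:: 1; 1; 1] `|` even_signed_perms 3 [:: 0; phi^-1; phi].

Definition icosahedron_vertices : {fset 'rV[R]_3} :=
  even_signed_perms 3 [:: 0; 1; phi].

Definition cell24_vertices : {fset 'rV[R]_4} :=
  all_signed_perms 4 [:: 1; 1; 0; 0].

Definition cell120_vertices : {fset 'rV[R]_4} :=
  all_signed_perms 4 [:: 0; 0; 2; 2]
  `|` all_signed_perms 4 [:: 1; 1; 1; Num.sqrt 5]
  `|` all_signed_perms 4 [:: phi ^- 2; phi; phi; phi]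
  `|` all_signed_perms 4 [:: phi^-1; phi^-1; phi^-1; phi ^+ 2]
  `|` even_signed_perms 4 [:: 0; phi ^- 2; 1; phi ^+ 2]
  `|` even_signed_perms 4 [:: 0; phi^-1; phi; Num.sqrt 5]
  `|` even_signed_perms 4 [:: phi^-1; 1; phi; 2].

Definition cell600_vertices : {fset 'rV[R]_4} :=
  all_signed_perms 4 [:: 2; 0; 0; 0]
  `|` all_signed_perms 4 [:: 1; 1; 1; 1]
  `|` even_signed_perms 4 [:: phi; 1; phi^-1; 0].

Definition model_vertices (P : regular_polytope) :
    {fset 'rV[R]_(model_dim P)} :=
  match P return {fset 'rV[R]_(model_dim P)} with
  | RegularPolygon k _ => polygon_vertices k
  | Simplex d _ => simplex_vertices d
  | Cube d _ => cube_vertices d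
  | Orthoplex d _ => orthoplex_vertices d
  | Dodecahedron => dodecahedron_vertices
  | Icosahedron => icosahedron_vertices
  | Cell24 => cell24_vertices
  | Cell120 => cell120_vertices
  | Cell600 => cell600_vertices
  end.

(* X is the vertex set of a polytope of type P, of any size and position, in a
   Euclidean space of any dimension: the image of the model under a similarity. *)
Definition is_vertex_set (P : regular_polytope) n (X : {fset 'rV[R]_n}) : Prop :=
  exists (c : R) (f : 'rV[R]_(model_dim P) -> 'rV[R]_n),
    [/\ 0 < c,
        forall x y, x \in model_vertices P -> y \in model_vertices P ->
          dist (f x) (f y) = c * dist x y
      & X = [fset f x | x in model_vertices P]].

Definition segment n (p q : 'rV[R]_n) : set 'rV[R]_n :=
  [set x | exists t : R, 0 <= t <= 1 /\ x = (1 - t) *: p + t *: q]%classic.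

Definition collinear n (p q r : 'rV[R]_n) : Prop :=
  exists u v : 'rV[R]_n, forall x, x \in [:: p; q; r] ->
    exists t : R, x = u + t *: v.

Definition parallel n (p q r s : 'rV[R]_n) : Prop :=
  exists t : R, t != 0 /\ s - r = t *: (q - p).

Definition simple_quadrilateral n (A B C D : 'rV[R]_n) : Prop :=
  (segment A B `&` segment C D = set0)%classic /\
  (segment B C `&` segment D A = set0)%classic.

Definition nondegenerate n (A B C D : 'rV[R]_n) : Prop :=
  [/\ ~ collinear A B C, ~ collinear B C D, ~ collinear C D A
    & ~ collinear D A B].

Definition parallelogram n (A B C D : 'rV[R]_n) : Prop :=
  parallel A B C D /\ parallel B C D A.

Definition right_angle n (p q r : 'rV[R]_n) : Prop :=
  dotp (p - q) (r - q) = 0.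

Definition rectangle n (A B C D : 'rV[R]_n) : Prop :=
  [/\ right_angle D A B, right_angle A B C, right_angle B C D
    & right_angle C D A].

(* The vertices A, B, C, D are listed in cyclic order, AB and CD being parallel
   and BC and DA of equal length. Since AB and CD are parallel, the four points
   are coplanar. *)
Definition isosceles_trapezium n (A B C D : 'rV[R]_n) : Prop :=
  [/\ simple_quadrilateral A B C D,
      nondegenerate A B C D,
      parallel A B C D,
      dist B C = dist D A
    & parallelogram A B C D -> rectangle A B C D].

End Models.

(* Main.v *)
(* Each set is placed inside an orbit of one vector under a soluble group of
   signed permutations of the coordinates: when H is a soluble permutation group
   of the coordinates, all sign changes together with H generate a soluble group.
   - For part 1, translate by the midpoint of alpha and beta: the entries become
     -d or d except for a single e, so arbitrary sign changes and the cyclic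
     shifts suffice.  Cubes, orthoplexes and simplices have the same shape.
   - The 24-cell is padded to five coordinates indexed by the field F_5; its
     supports are pairs of coordinates, and the soluble group of affine maps of
     F_5 is 2-transitive.
   - The ten axes through opposite vertices of a dodecahedron are labelled by the
     pairs of elements of F_5, so that the angle between two axes only depends on
     how the pairs meet.  Projecting on the ten axes is a similarity, and makes
     every vertex a signed permutation, by an affine map, of every other one.
   - For a trapezium with parallel sides 2a and 2b and height h, choose a
     sequence c_0 = a, ..., c_N = b with sum of (c_j - c_{j+1})^2 = h^2.  The
     vertices are (+-c_0, c_1, ..., c_N) and (+-c_N, c_0, ..., c_{N-1}). *)
Require Import Defs.
From HB Require Import structures.
From mathcomp Require Import all_boot all_order all_algebra all_fingroup all_solvable.
From mathcomp Require Import finmap.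
From mathcomp Require Import classical_sets reals trigo.
From mathcomp Require Import ring lra.

Set Implicit Arguments.
Unset Strict Implicit.
Unset Printing Implicit Defensive.

Import Order.TTheory GRing.Theory Num.Theory.

Local Open Scope fset_scope.
Local Open Scope ring_scope.

(** * Euclidean distance *)

Section Dist.
Variables (R : realType) (n : nat).
Implicit Types x y : 'rV[R]_n.

Lemma dotp_ge0 x : 0 <= dotp x x.
Proof. by apply: sumr_ge0 => i _; rewrite -expr2 sqr_ge0. Qed.

Lemma distE x y : dist x y = Num.sqrt (\sum_i (x 0 i - y 0 i) ^+ 2).
Proof. by congr Num.sqrt; apply: eq_bigr => i _; rewrite !mxE expr2. Qed.

Lemma sqr_dist x y : dist x y ^+ 2 = \sum_i (x 0 i - y 0 i) ^+ 2.
Proof. by rewrite distE sqr_sqrtr // sumr_ge0 // => i _; rewrite sqr_ge0. Qed.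

Lemma dist_ge0 x y : 0 <= dist x y.
Proof. exact: sqrtr_ge0. Qed.

Lemma distxx x : dist x x = 0.
Proof.
by apply/eqP; rewrite -sqrf_eq0 sqr_dist big1 // => i _; rewrite subrr expr0n.
Qed.

Lemma dist0_eq x y : dist x y = 0 -> x = y.
Proof.
move=> d0; have : \sum_i (x 0 i - y 0 i) ^+ 2 = 0 by rewrite -sqr_dist d0 expr0n.
move/eqP; rewrite psumr_eq0 => [/allP xy0|i _]; last exact: sqr_ge0.
apply/rowP => i; apply/eqP; rewrite -subr_eq0 -sqrf_eq0.
by apply: xy0; rewrite mem_index_enum.
Qed.

Lemma distZ (c : R) x y : 0 <= c -> dist (c *: x) (c *: y) = c * dist x y.
Proof.
move=> c0; apply/eqP; rewrite -(@eqrXn2 _ 2) ?mulr_ge0 ?dist_ge0 //.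
rewrite exprMn !sqr_dist mulr_sumr; apply/eqP/eq_bigr => i _.
by rewrite !mxE -mulrBr exprMn.
Qed.

End Dist.

(** * Orbits of soluble groups and embeddings into them *)

(** Makes [P g] to [P (g * k)] a well-defined isometry of the image of [P], so that no action on the
    ambient space has to be given. *)
Definition right_invariant (R : realType) (gT : finGroupType) (G : {group gT})
    n (P : gT -> 'rV[R]_n) : Prop :=
  {in G & &, forall g h k, dist (P (g * k)%g) (P (h * k)%g) = dist (P g) (P h)}.

(** Right multiplication descends to the points: if [P g = P h], then [P (g * k)] and [P (h * k)]
    are at distance zero. *)
Lemma orbit_soluble (R : realType) (gT : finGroupType) (G : {group gT}) n
    (P : gT -> 'rV[R]_n) :
  solvable G -> right_invariant G P -> soluble [fset P g | g in G].
Proof.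
move=> solG invP; set Y := [fset P g | g in G].
have PY g : g \in G -> P g \in Y by move=> Gg; apply/imfsetP; exists g.
have YP (y : Y) : exists g, (g \in G) && (P g == val y).
  by case: y => y /= /imfsetP[g /= Gg ->]; exists g; rewrite Gg eqxx.
pose r y := xchoose (YP y).
have rG y : r y \in G by have /andP[] := xchooseP (YP y).
have rP y : P (r y) = val y by have /andP[_ /eqP] := xchooseP (YP y).
(* Elements outside [G] act as the identity: an action must be injective in [y] for every [k] of the
   ambient type. *)
pose f (y : Y) k : Y :=
  if insub k : {? k | k \in G} is Some k' then
    [` PY _ (groupM (rG y) (valP k'))] else y.
have fE y k : k \in G -> val (f y k) = P (r y * k)%g.
  by move=> Gk; rewrite /f insubT.
have P_mul g h k : g \in G -> h \in G -> k \in G -> P g = P h -> P (g * k)%g = P (h * k)%g.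
  by move=> Gg Gh Gk gh; apply: dist0_eq; rewrite invP // gh distxx.
have fM y : {in G &, act_morph f y}.
  move=> a b Ga Gb; apply: val_inj; rewrite !fE ?groupM // mulgA.
  by apply: P_mul; rewrite ?groupM // rP fE.
have f1 y : f y 1%g = y by apply: val_inj; rewrite fE // mulg1 rP.
have finj : left_injective f.
  move=> k; case: (boolP (k \in G)) => [Gk|nGk].
    apply: (can_inj (g := f ^~ k^-1%g)) => y.
    by rewrite -fM ?groupV // mulgV f1.
  by move=> y z; rewrite /f insubN.
have fA : is_action G f by split.
exists gT, G, (Action fA); split => //.
  by move=> k Gk x y; rewrite /= !fE // invP // !rP.
apply/imsetP; exists [` PY 1%g (group1 G)]; rewrite ?inE //.
apply/setP => y; rewrite inE; apply/esym/imsetP; exists (r y) => //.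
apply: val_inj; rewrite /= fE // -rP -[LHS]/(P (r y)) -[in LHS](mul1g (r y)).
by apply: P_mul => //; rewrite rP.
Qed.

Definition orbit_embeddable (R : realType) d (M : {fset 'rV[R]_d}) : Prop :=
  exists (gT : finGroupType) (G : {group gT}) (n : nat) (P : gT -> 'rV[R]_n)
         (phi : 'rV[R]_d -> gT),
    [/\ solvable G, right_invariant G P, {in M, forall x, phi x \in G}
      & {in M &, forall x y, dist (P (phi x)) (P (phi y)) = dist x y}].

(** Rescaling [P] by [c] keeps it right invariant, and a point of [X] is sent where any chosen
    preimage under [f] in [M] is sent. *)
Lemma orbit_embeddable_similar (R : realType) d (M : {fset 'rV[R]_d}) (c : R) n
    (f : 'rV[R]_d -> 'rV[R]_n) (X : {fset 'rV[R]_n}) :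
  0 <= c ->
  (forall x y, x \in M -> y \in M -> dist (f x) (f y) = c * dist x y) ->
  {subset X <= [fset f x | x in M]} ->
  orbit_embeddable M -> subsoluble X.
Proof.
move=> c0 fc XM [gT [G [m [P [phi [solG invP phiG phiP]]]]]].
pose Q g := c *: P g.
have invQ : right_invariant G Q by move=> g h k Gg Gh Gk; rewrite !distZ // invP.
pose psi p := xget 0 [set x | x \in M /\ f x = p]%classic.
have psiP p : p \in X -> psi p \in M /\ f (psi p) = p.
  move=> Xp; have /imfsetP[x /= Mx ->] := XM p Xp.
  exact: (@xgetI _ 0 [set y | y \in M /\ f y = f x]%classic x).
exists m, [fset Q g | g in G], (fun p => Q (phi (psi p))); split.
- exact: orbit_soluble.
- by move=> p /psiP[Mp _]; apply/imfsetP; exists (phi (psi p)) => //=; exact: phiG.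
- move=> p q /psiP[Mp fp] /psiP[Mq fq].
  by rewrite distZ // phiP // -fc // fp fq.
Qed.

Lemma orbit_embeddable_subsoluble (R : realType) d (M : {fset 'rV[R]_d}) :
  orbit_embeddable M -> subsoluble M.
Proof.
apply: (@orbit_embeddable_similar _ _ _ 1 _ id) => //.
- by move=> x y _ _; rewrite mul1r.
- by move=> x Mx; apply/imfsetP; exists x.
Qed.

(** All the families [F x] are rearrangements of the single [v] by elements of [H], hence lie in one
    orbit of [H]; as [F] multiplies squared distances by [c], the orbit is scaled down by the square
    root of [c]. *)
Lemma perm_orbit_embeddable (R : realType) (I : finType) (H : {group {perm I}})
    (v : I -> R) d (M : {fset 'rV[R]_d}) (F : 'rV[R]_d -> I -> R) (c : R) :
  0 < c -> solvable H ->
  {in M, forall x, exists2 h, h \in H & forall i, F x i = v (h i)} ->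
  {in M &, forall x y, \sum_i (F x i - F y i) ^+ 2 = c * dist x y ^+ 2} ->
  orbit_embeddable M.
Proof.
move=> c0 solH FH Fdist.
(* Because of the inverse, right multiplication by [k] amounts to reindexing the coordinates by the
   inverse of [k], which preserves distances. *)
pose P (g : {perm I}) : 'rV[R]_#|I| :=
  \row_j ((Num.sqrt c)^-1 * v ((g^-1)%g (enum_val j))).
have PE g h : dist (P g) (P h) ^+ 2 =
    c^-1 * \sum_i (v (g^-1 i)%g - v (h^-1 i)%g) ^+ 2.
  rewrite sqr_dist mulr_sumr (reindex _ (onW_bij _ (@enum_rank_bij I))) /=.
  apply: eq_bigr => i _; rewrite !mxE enum_rankK -mulrBr exprMn exprVn.
  by rewrite sqr_sqrtr // ltW.
pose phi x := if [pick h in H | [forall i, F x i == v (h i)]] is Some h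
              then (h^-1)%g else 1%g.
have phiP x : x \in M -> phi x \in H /\ forall i, F x i = v ((phi x)^-1 i)%g.
  move=> /FH[h Hh Fh]; rewrite /phi; case: pickP => [k /andP[Hk /forallP Fk]|].
    by rewrite groupV; split=> // i; rewrite invgK; exact/eqP.
  by move=> /(_ h); rewrite Hh => /forallP[] i; rewrite Fh.
exists {perm I}, H, #|I|, P, phi; split => //.
- move=> g h k Hg Hh Hk; apply/eqP; rewrite -(@eqrXn2 _ 2) ?dist_ge0 // !PE.
  rewrite [in X in _ == X](reindex_inj (@perm_inj _ (k^-1)%g)) /=.
  by under eq_bigr do rewrite !invMg !permM.
- by move=> x /phiP[].
- move=> x y Mx My; have [_ Fx] := phiP x Mx; have [_ Fy] := phiP y My.
  apply/eqP; rewrite -(@eqrXn2 _ 2) ?dist_ge0 // PE.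
  under eq_bigr do rewrite -Fx -Fy.
  by rewrite Fdist // mulKf // gt_eqF.
Qed.

(** * Soluble groups of signed permutations *)

Lemma solvable_ker_morphim (aT rT : finGroupType) (G : {group aT})
    (f : {morphism G >-> rT}) :
  solvable ('ker f) -> solvable (f @* G) -> solvable G.
Proof.
move=> solK solfG; rewrite (series_sol (ker_normal f)) solK /=.
by rewrite (isog_sol (first_isog f)).
Qed.

(* A signed permutation of I is encoded as a permutation of I * bool that maps
   fibres to fibres: (i, b) stands for the coordinate i with the sign (-1)^b. *)
Section SignedPermutations.
Variables (I : finType) (H : {group {perm I}}).

Definition lies_over (g : {perm I * bool}) (h : {perm I}) :=
  [forall t, (g t).1 == h t.1].

Lemma lies_overP (g : {perm I * bool}) (h : {perm I}) :
  reflect (forall t, (g t).1 = h t.1) (lies_over g h).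
Proof. by apply: (iffP forallP) => gh t; apply/eqP. Qed.

Lemma lies_over_uniq g h k : lies_over g h -> lies_over g k -> h = k.
Proof.
move=> /lies_overP gh /lies_overP gk; apply/permP => i.
by rewrite -[i]/((i, true).1) -gh gk.
Qed.

Lemma lies_overM g h g' h' :
  lies_over g h -> lies_over g' h' -> lies_over (g * g')%g (h * h')%g.
Proof.
move=> /lies_overP gh /lies_overP gh'; apply/lies_overP => t.
by rewrite !permM gh' gh.
Qed.

Definition signed_lift := [set g | [exists h in H, lies_over g h]].

Lemma signed_lift_group_set : group_set signed_lift.
Proof.
apply/group_setP; split => [|g g'].
  rewrite inE; apply/exists_inP; exists 1%g => //.
  by apply/lies_overP => t; rewrite !perm1.
rewrite !inE => /exists_inP[h Hh gh] /exists_inP[h' Hh' gh'].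
by apply/exists_inP; exists (h * h')%g; rewrite ?groupM ?lies_overM.
Qed.

Canonical signed_lift_group := Group signed_lift_group_set.

Definition perm_part (g : {perm I * bool}) : {perm I} :=
  odflt 1%g [pick h in H | lies_over g h].

Lemma perm_partP g : g \in signed_lift ->
  perm_part g \in H /\ lies_over g (perm_part g).
Proof.
rewrite inE /perm_part => /exists_inP[h Hh gh].
by case: pickP => [k /andP[]//|/(_ h)]; rewrite Hh gh.
Qed.

Lemma perm_partM : {in signed_lift &, {morph perm_part : g h / (g * h)%g}}.
Proof.
move=> g g' Gg Gg'; have [_ p] := perm_partP (groupM Gg Gg').
apply: (lies_over_uniq p); have [_ q] := perm_partP Gg.
by have [_ q'] := perm_partP Gg'; exact: lies_overM.
Qed.

Canonical perm_part_morphism := Morphism perm_partM.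

(** The kernel of [perm_part] consists of the pure sign changes, which commute, and its image lies
    in [H]. *)
Lemma signed_lift_solvable : solvable H -> solvable signed_lift.
Proof.
move=> solH; apply: (@solvable_ker_morphim _ _ _ perm_part_morphism).
  apply/abelian_sol/centsP => g Kg h Kh.
  (* An element of the kernel preserves every fibre, so on the fibre of [i] it either fixes or
     exchanges the two signs; [e i] is read off at the sign [false]. *)
  have sgn k : k \in ('ker perm_part_morphism)%g -> exists e : I -> bool,
      forall i b, k (i, b) = (i, b (+) e i).
    move=> /morphpreP[Gk /set1P k1]; have [_ /lies_overP] := perm_partP Gk.
    rewrite [perm_part k]k1 => kfst; exists (fun i => (k (i, false)).2) => i b.
    have kE c : k (i, c) = (i, (k (i, c)).2).
      by rewrite [LHS]surjective_pairing kfst perm1.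
    rewrite kE; congr (_, _); case: b => //=.
    have: k (i, true) != k (i, false) by rewrite (inj_eq perm_inj) eqE /= andbF.
    rewrite [X in X != _]kE [X in _ != X]kE xpair_eqE eqxx /=.
    by do 2![case: (_.2)].
  have [e ge] := sgn g Kg; have [e' he] := sgn h Kh.
  by apply/permP => -[i b]; rewrite !permM ge !he ge addbAC.
apply: solvableS solH. apply/fintype.subsetP => _ /morphimP[g _ Gg ->].
by have [] := perm_partP Gg.
Qed.

Lemma signed_perm_inj (h : {perm I}) (e : I -> bool) :
  injective (fun t : I * bool => (h t.1, t.2 (+) e t.1)).
Proof.
move=> [i b] [j c] /= [/perm_inj -> /eqP]; rewrite (inj_eq (@addIb _)).
by move/eqP->.
Qed.

End SignedPermutations.

(** Listing each coordinate with both signs turns signed permutations of [v] into permutations of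
    [w]. Only absolute values matter, since all sign changes are available, and each square is
    counted twice, whence [c *+ 2]. *)
Lemma signed_orbit_embeddable (R : realType) (I : finType) (H : {group {perm I}})
    (v : I -> R) d (M : {fset 'rV[R]_d}) (F : 'rV[R]_d -> I -> R) (c : R) :
  0 < c -> solvable H ->
  {in M, forall x, exists2 h, h \in H & forall i, `|F x i| = `|v (h i)|} ->
  {in M &, forall x y, \sum_i (F x i - F y i) ^+ 2 = c * dist x y ^+ 2} ->
  orbit_embeddable M.
Proof.
move=> c0 solH FH Fdist.
pose w (t : I * bool) := (-1) ^+ t.2 * v t.1.
pose F2 x (t : I * bool) := (-1) ^+ t.2 * F x t.1.
apply: (@perm_orbit_embeddable _ _ (signed_lift_group H) w _ _ F2 (c *+ 2)).
- by rewrite pmulrn_rgt0.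
- exact: signed_lift_solvable.
- move=> x /FH[h Hh Fh]; pose e i := F x i != v (h i).
  exists (perm (@signed_perm_inj _ h e)).
    rewrite inE; apply/exists_inP; exists h => //.
    by apply/lies_overP => t; rewrite permE.
  move=> [i b]; rewrite permE /F2 /w /= /e; have /eqP := Fh i.
  rewrite eqr_norm2; case: eqVneq => [-> _|_ /= /eqP ->]; first by rewrite addbF.
  by rewrite signr_addb mulrN mulrN1 mulNr.
- move=> x y Mx My.
  rewrite -(pair_bigA _ (fun i b => (F2 x (i, b) - F2 y (i, b)) ^+ 2)) /=.
  rewrite mulrnAl -Fdist // -sumrMnl; apply: eq_bigr => i _.
  by rewrite big_bool /F2 /= -!mulrBr !exprMn !sqrr_sign mul1r.
Qed.

(** * Translations and affine maps *)

Section Translations.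
Variable V : finZmodType.

Definition translation (a : V) : {perm V} := perm (addrI a).

Lemma translationM a b : (translation a * translation b)%g = translation (b + a).
Proof. by apply/permP => x; rewrite permM !permE addrA. Qed.

Definition translations := [set translation a | a : V].

Lemma translations_group_set : group_set translations.
Proof.
apply/group_setP; split => [|_ _ /imsetP[a _ ->] /imsetP[b _ ->]].
  by apply/imsetP; exists 0 => //; apply/permP => x; rewrite perm1 permE add0r.
by rewrite translationM imset_f.
Qed.

Canonical translations_group := Group translations_group_set.

Lemma translations_abelian : abelian translations.
Proof.
apply/centsP => _ /imsetP[a _ ->] _ /imsetP[b _ ->].
by rewrite /commute !translationM addrC.
Qed.

Lemma translations_transitive x y : exists2 h, h \in translations & h x = y.
Proof. by exists (translation (y - x)); rewrite ?imset_f // permE subrK. Qed.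

End Translations.

Section Affine.
Variable K : finFieldType.

Definition is_affine (g : {perm K}) (a b : K) := [forall x, g x == a * x + b].

Definition affine_perms := [set g | [exists a, exists b, is_affine g a b]].

Lemma affineP (g : {perm K}) :
  reflect (exists a b, forall x, g x = a * x + b) (g \in affine_perms).
Proof.
rewrite inE; apply: (iffP existsP) => [[a /existsP[b /forallP gab]]|[a [b gab]]].
  by exists a, b => x; exact/eqP.
by exists a; apply/existsP; exists b; apply/forallP => x; rewrite gab.
Qed.

Lemma affine_group_set : group_set affine_perms.
Proof.
apply/group_setP; split => [|g h /affineP[a [b ga]] /affineP[a' [b' ha]]].
  by apply/affineP; exists 1, 0 => x; rewrite perm1 mul1r addr0.
apply/affineP; exists (a' * a), (a' * b + b') => x.
by rewrite permM ha ga mulrDr mulrA addrA.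
Qed.

Canonical affine_group := Group affine_group_set.

Lemma affine_slope_neq0 (g : {perm K}) a b : (forall x, g x = a * x + b) -> a != 0.
Proof.
move=> ga; apply/eqP => a0; have /perm_inj/eqP : g 0 = g 1 by rewrite !ga a0 !mul0r.
by rewrite eq_sym oner_eq0.
Qed.

(** Slopes multiply in a commutative field, so a commutator has slope 1 and is the translation by
    its value at 0. *)
Lemma affine_derived : [~: affine_group, affine_group]%g \subset translations K.
Proof.
rewrite gen_subG; apply/fintype.subsetP => _ /imset2P[g h Gg Gh ->].
have [a [b gab]] := affineP g Gg; have [c [d hcd]] := affineP h Gh.
have a0 := affine_slope_neq0 gab; have c0 := affine_slope_neq0 hcd.
have gV x : (g^-1 x)%g = a^-1 * (x - b).
  by apply: (@perm_inj _ g); rewrite permKV gab mulVKf // subrK.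
have hV x : (h^-1 x)%g = c^-1 * (x - d).
  by apply: (@perm_inj _ h); rewrite permKV hcd mulVKf // subrK.
apply/imsetP; exists (([~ g, h])%g 0) => //; apply/permP => x.
rewrite [translation _ _]permE !permM !hcd !gab. rewrite !hV !gV.
by field; rewrite a0 c0.
Qed.

Lemma affine_solvable : solvable affine_group.
Proof.
(* By definition of [solvable], a subgroup [H] contained in its own derived group has to be trivial.
   Such an [H] consists of translations, which commute. *)
apply/forall_inP => H /subsetIP[sHG sHH].
have sHT : H \subset translations K.
  exact: fintype.subset_trans sHH (fintype.subset_trans (commgSS sHG sHG) affine_derived).
rewrite -subG1; apply: fintype.subset_trans sHH _.
have /commG1P <- := translations_abelian K; exact: commgSS.
Qed.

Lemma affine_2transitive x y x' y' : x != y -> x' != y' ->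
  exists2 h, h \in affine_group & h x = x' /\ h y = y'.
Proof.
move=> xy xy'; have xy0 : x - y != 0 by rewrite subr_eq0.
(* The slope of the line through the points [(x, x')] and [(y, y')]. *)
pose a := (x' - y') / (x - y); have a0 : a != 0.
  by rewrite mulf_neq0 ?invr_eq0 // subr_eq0.
have inj : injective (fun z => a * z + (x' - a * x)).
  by move=> z t /addIr/(mulfI a0).
exists (perm inj); first by apply/affineP; exists a, (x' - a * x) => z; rewrite permE.
by rewrite !permE /a; split; field.
Qed.

End Affine.

Lemma ord_transitive_solvable n :
  exists2 H : {group 'S_n}, solvable H & forall x y, exists2 h, h \in H & h x = y.
Proof.
case: n => [|n]; first by exists 1%G; [exact: solvable1|case].
exists (translations_group 'I_n.+1); last exact: translations_transitive.
exact/abelian_sol/translations_abelian.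
Qed.

(** * Coordinate permutations, polygons, simplices, cubes, orthoplexes *)

Lemma signed_rows_embeddable (R : realType) n (H : {group 'S_n}) (v : 'I_n -> R)
    (m : R) (M : {fset 'rV[R]_n}) :
  solvable H ->
  {in M, forall x : 'rV[R]_n, exists2 h, h \in H & forall i, `|x 0 i - m| = `|v (h i)|} ->
  orbit_embeddable M.
Proof.
move=> solH HM.
apply: (@signed_orbit_embeddable _ _ H v _ _ (fun x i => x 0 i - m) 1) => //.
move=> x y _ _; rewrite mul1r sqr_dist; apply: eq_bigr => i _.
by congr (_ ^+ 2); rewrite opprB addrA subrK.
Qed.

(** Up to signs, the vectors centred at [m] are determined by the position [k] of the special entry,
    and a transitive soluble group moves [k] to 0. *)
Lemma one_special_coord_embeddable (R : realType) n (m a b : R)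
    (M : {fset 'rV[R]_n}) :
  {in M, forall x : 'rV[R]_n, exists k, forall i, `|x 0 i - m| = if i == k then `|b| else `|a|} ->
  orbit_embeddable M.
Proof.
move=> HM; have [H solH trH] := ord_transitive_solvable n.
case: n => [|n] in M HM H solH trH *.
  by apply: (@signed_rows_embeddable _ _ H (fun=> 0) m) => // x /HM[[]].
apply: (@signed_rows_embeddable _ _ H (fun i => if i == 0 then b else a) m) => // x.
move=> /HM[k xk]; have [h Hh hk] := trH k 0; exists h => // i.
by rewrite xk -hk (inj_eq perm_inj); case: eqP.
Qed.

Lemma coord_perms_embeddable (R : realType) (a b c : R) (i j : nat) :
  orbit_embeddable
    (coord_perms (row_mx (row_mx (const_mx a : 'rV[R]_i) (const_mx b : 'rV[R]_j))
                         (const_mx c : 'rV[R]_1))).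
Proof.
pose m := (a + b) / 2.
apply: (@one_special_coord_embeddable _ _ m ((a - b) / 2) (c - m)).
(* [col_perm s] reads the entry at [s k], so [c] sits at the preimage of the last index. *)
move=> _ /imfsetP[s _ ->]; exists ((s^-1)%g (rshift (i + j) 0)) => k.
rewrite mxE -[k in X in _ = X](permK s) (inj_eq perm_inj).
case: (split_ordP (s k)) => l ->; last first.
  by rewrite row_mxEr mxE (ord1 l) eqxx.
rewrite eq_lrshift row_mxEl; case: (split_ordP l) => l' ->.
  by rewrite row_mxEl mxE; congr `|_|; rewrite /m; field.
by rewrite row_mxEr mxE -normrN; congr `|_|; rewrite /m; field.
Qed.

(** Here the group is the cyclic group of rotations, realised as the additive group of ['I_k.+1]:
    distances depend only on differences of angles. *)
Lemma polygon_embeddable (R : realType) k :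
  orbit_embeddable (polygon_vertices R k).
Proof.
case: k => [|k].
  exists {perm bool}, 1%G, 0, (fun=> 0), (fun=> 1%g).
  split=> [||x|x y]; [exact: solvable1|by move=> *; rewrite !distxx|..];
    by move=> /imfsetP[[]].
pose th : R := 2 * pi / k.+1%:R.
pose P (i : 'I_k.+1) := row_of_seq 2 [:: cos (th * i%:R); sin (th * i%:R)].
have distP i j : dist (P i) (P j) ^+ 2 = 2 - 2 * cos (th * i%:R - th * j%:R).
  rewrite sqr_dist !big_ord_recl big_ord0 !mxE /= cosB.
  have := cos2Dsin2 (th * i%:R); have := cos2Dsin2 (th * j%:R) => e1 e2.
  rewrite addr0; transitivity ((cos (th * i%:R) ^+ 2 + sin (th * i%:R) ^+ 2) +
    (cos (th * j%:R) ^+ 2 + sin (th * j%:R) ^+ 2) -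
    2 * (cos (th * i%:R) * cos (th * j%:R) + sin (th * i%:R) * sin (th * j%:R))); first by ring.
  by rewrite e1 e2; ring.
(* The group law reduces the index modulo [k.+1], which changes the angle by a multiple of
   [2 * pi]. *)
have shift (i l : 'I_k.+1) : cos (th * (i * l)%g%:R) = cos (th * i%:R + th * l%:R) /\
                            sin (th * (i * l)%g%:R) = sin (th * i%:R + th * l%:R).
  rewrite -mulrDr -natrD [in X in _ = cos X /\ _ = sin X](divn_eq (i + l) k.+1).
  rewrite natrD mulrDr addrC.
  have -> : th * ((i + l) %/ k.+1 * k.+1)%:R = (pi *+ 2) *+ ((i + l) %/ k.+1).
    by rewrite natrM mulrCA /th divfK ?pnatr_eq0 // mulr_natl mulr_natl.
  by rewrite (periodicn (@cosD2pi R)) (periodicn (@sinD2pi R)).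
pose ph (x : 'rV[R]_2) : 'I_k.+1 := odflt 0 [pick i | x == P i].
exists 'I_k.+1, [set: 'I_k.+1]%G, 2, P, ph; split.
- exact/abelian_sol/Zp_abelian.
- move=> i j l _ _ _; apply/eqP; rewrite -(@eqrXn2 _ 2) ?dist_ge0 // !distP.
  rewrite 2!cosB (shift i l).1 (shift i l).2 (shift j l).1 (shift j l).2.
  by rewrite -!cosB opprD addrACA subrr addr0.
- by move=> x _; rewrite inE.
- have phP x : x \in polygon_vertices R k.+1 -> P (ph x) = x.
    move=> /imfsetP[i _ ->]; rewrite /ph; case: pickP => [j /eqP//|/(_ i)].
    by rewrite /P /th mulrAC eqxx.
  by move=> x y Mx My; rewrite !phP.
Qed.

Lemma simplex_embeddable (R : realType) d : orbit_embeddable (simplex_vertices R d).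
Proof.
apply: (@one_special_coord_embeddable _ _ 0 0 1) => _ /imfsetP[k _ ->].
by exists k => i; rewrite !mxE subr0 /=; case: eqP => _; rewrite ?normr1 ?normr0.
Qed.

Lemma cube_embeddable (R : realType) d : (0 < d)%N -> orbit_embeddable (cube_vertices R d).
Proof.
move=> d0; apply: (@one_special_coord_embeddable _ _ 0 1 1) => _ /imfsetP[e _ ->].
(* All entries have absolute value 1, so any index can serve as the special one. *)
by exists (Ordinal d0) => i; rewrite !mxE subr0 normr_sign if_same normr1.
Qed.

Lemma orthoplex_embeddable (R : realType) d : orbit_embeddable (orthoplex_vertices R d).
Proof.
apply: (@one_special_coord_embeddable _ _ 0 0 1) => _ /imfset2P[k _ [b _ ->]].
exists k => i; rewrite !mxE subr0 /= normrM normr_sign mul1r.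
by case: eqP => _; rewrite ?normr1 ?normr0.
Qed.

(** * The icosahedron and the 24-cell *)

(** The three cyclic shifts are even and there are only three even permutations. *)
Lemma even_perm3 (p : 'S_3) : ~~ odd_perm p -> exists a, p = translation (a : 'I_3).
Proof.
move=> p_even; suff: p \in translations 'I_3 by case/imsetP => a _ ->; exists a.
have sub : translations 'I_3 \subset ('Alt_('I_3))%g.
  apply/fintype.subsetP => _ /imsetP[a _ ->]; rewrite Alt_even.
  (* Since 4a = a modulo 3, each shift is a square and therefore even. *)
  have -> : translation a = (translation (a + a) * translation (a + a))%g.
    rewrite translationM; congr translation; apply/val_inj.
    by case: a => -[|[|[|]]].
  by rewrite odd_permM addbb.
have -> : translations 'I_3 = ('Alt_('I_3))%g; last by rewrite Alt_even.
apply/eqP; rewrite eqEcard sub /=.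
rewrite card_imset ?card_ord; last first.
  by move=> a b /permP/(_ 0); rewrite !permE !addr0.
have := @card_Alt 'I_3; rewrite card_ord => /(_ isT) c.
by rewrite -(leq_pmul2l (ltn0Sn 1)) c.
Qed.

Lemma icosahedron_embeddable (R : realType) : orbit_embeddable (icosahedron_vertices R).
Proof.
apply: (@signed_rows_embeddable _ _ (translations_group 'I_3)
          (row_of_seq 3 [:: 0; 1; golden R] 0) 0).
  exact/abelian_sol/translations_abelian.
move=> _ /imfset2P[p /= + [e _ ->]]; rewrite inE => /even_perm3[a ->].
by exists (translation a) => [|i]; rewrite ?imset_f // mxE subr0 normrM normr_sign mul1r.
Qed.

Lemma cell24_embeddable (R : realType) : orbit_embeddable (cell24_vertices R).
Proof.
pose F (x : 'rV[R]_4) (i : 'F_5) := if (i < 4)%N then x 0 (inord i) else 0.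
pose v (i : 'F_5) : R := ((i == 0) || (i == 1))%:R.
apply: (@signed_orbit_embeddable _ _ (affine_group 'F_5) v _ _ F 1) => //.
- exact: affine_solvable.
- move=> _ /imfset2P[p _ [e _ ->]].
  (* The positions of the two nonzero entries; [h] carries them to 0 and 1, the support of [v]. *)
  pose k : 'I_4 := (p^-1)%g 0; pose l : 'I_4 := (p^-1)%g 1.
  pose j5 (j : 'I_4) : 'F_5 := Ordinal (ltn_trans (ltn_ord j) (ltnSn 4)).
  have kl : j5 k != j5 l.
    by rewrite -val_eqE /= val_eqE (inj_eq perm_inj).
  have [h Hh [hk hl]] := affine_2transitive kl (isT : (0 : 'F_5) != 1).
  exists h => // i; rewrite /v -hk -hl !(inj_eq perm_inj) normr_nat /F.
  case: ltnP => [i4|i4]; last first.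
    rewrite normr0 -!val_eqE /= !gtn_eqF ?(leq_trans (ltn_ord _)) //.
  rewrite !mxE normrM normr_sign mul1r.
  have j5E j : (i == j5 j) = (p (inord i) == p j).
    by rewrite (inj_eq perm_inj) -val_eqE -[RHS]val_eqE /= inordK.
  rewrite !j5E !permKV; case: (p _) => -[|[|[|[|//]]]] q;
    by rewrite /= ?normr1 ?normr0.
move=> x y _ _; rewrite mul1r sqr_dist.
rewrite -[LHS]/(\sum_(i < 5) (F x i - F y i) ^+ 2) big_ord_recr /= {2}/F /= subr0 expr0n addr0.
by apply: eq_bigr => i _; rewrite /F /= ltn_ord inord_val.
Qed.

(** * Scalar products and isosceles trapezia *)

Section Dotp.
Variables (R : realType) (n : nat).
Implicit Types x y z : 'rV[R]_n.

Lemma dotpC x y : dotp x y = dotp y x.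
Proof. by apply: eq_bigr => i _; rewrite mulrC. Qed.

Lemma dotpDl x y z : dotp (x + y) z = dotp x z + dotp y z.
Proof. by rewrite -big_split; apply: eq_bigr => i _; rewrite mxE mulrDl. Qed.

Lemma dotpZl (c : R) x y : dotp (c *: x) y = c * dotp x y.
Proof. by rewrite mulr_sumr; apply: eq_bigr => i _; rewrite mxE mulrA. Qed.

Lemma dotpDr x y z : dotp x (y + z) = dotp x y + dotp x z.
Proof. by rewrite dotpC dotpDl !(dotpC x). Qed.

Lemma dotpZr (c : R) x y : dotp x (c *: y) = c * dotp x y.
Proof. by rewrite dotpC dotpZl dotpC. Qed.

Lemma dotp_gt0 x : x != 0 -> 0 < dotp x x.
Proof.
rewrite lt_neqAle dotp_ge0 andbT; apply: contra_neq => x0.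
by apply: dist0_eq; rewrite /dist subr0 -x0 sqrtr0.
Qed.

Lemma sqr_dist_dotp x y : dist x y ^+ 2 = dotp (x - y) (x - y).
Proof. by rewrite sqr_sqrtr // dotp_ge0. Qed.

End Dotp.

(** Going from [a] to [b] in [m] equal steps costs [(b - a) ^+ 2 / m], at most [e] for large [m];
    the rest of [e] is spent on a detour from [b] to [b + r] and back. *)
Lemma path_of_energy (R : realType) (a b e : R) : 0 < e ->
  exists N (c : nat -> R), [/\ c 0%N = a, c N = b
    & \sum_(j < N) (c j - c j.+1) ^+ 2 = e].
Proof.
move=> e0; pose m := (Num.truncn ((b - a) ^+ 2 / e)).+1.
have m0 : 0 < m%:R :> R by rewrite ltr0n.
have me : (b - a) ^+ 2 / m%:R <= e.
  rewrite ler_pdivrMr // mulrC -ler_pdivrMr // ltW //.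
  by rewrite truncnS_gt.
pose r := Num.sqrt ((e - (b - a) ^+ 2 / m%:R) / 2).
pose c j := if (j <= m)%N then a + (b - a) * j%:R / m%:R
            else if j == m.+1 then b + r else b.
exists m.+2, c; split.
- by rewrite /c mulr0 mul0r addr0.
- by rewrite /c ltnNge leqnSn /= gtn_eqF.
have cm : c m = b by rewrite /c leqnn mulfK ?gt_eqF // addrC subrK.
have cm1 : c m.+1 = b + r by rewrite /c ltnn eqxx.
have cm2 : c m.+2 = b by rewrite /c ltnNge leqnSn /= gtn_eqF.
rewrite 2!big_ord_recr /= cm cm1 cm2.
have -> : \sum_(j < m) (c j - c j.+1) ^+ 2 = \sum_(j < m) (b - a) ^+ 2 / m%:R ^+ 2.
  apply: eq_bigr => j _; rewrite /c ltn_ord ltnW // -natr1.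
  by field; rewrite gt_eqF.
rewrite sumr_const card_ord -mulr_natl.
have r2 : r ^+ 2 = (e - (b - a) ^+ 2 / m%:R) / 2.
  by rewrite sqr_sqrtr // divr_ge0 // subr_ge0.
have -> : (b - (b + r)) ^+ 2 = r ^+ 2 by ring.
have -> : (b + r - b) ^+ 2 = r ^+ 2 by ring.
by rewrite r2; field; rewrite gt_eqF.
Qed.

(** Coordinate 0 of [F] measures the component along [u]; the others interpolate from [c i] at
    height [t = 0] to [c i.-1] at [t = 1], so moving by [w] changes their squares by the energy of
    [c], the squared length of [w]. *)
Lemma symmetric_trapezium_embeddable (R : realType) n (m u w : 'rV[R]_n) (s : R)
    (X : {fset 'rV[R]_n}) :
  u != 0 -> w != 0 -> dotp u w = 0 ->
  {in X, forall x : 'rV[R]_n, exists k t, x = m + k *: u + t *: w /\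
     (t = 0 /\ `|k| = 1 \/ t = 1 /\ `|k| = `|s|)} ->
  orbit_embeddable X.
Proof.
move=> /dotp_gt0 u0 /dotp_gt0 w0 uw XP.
pose nu := Num.sqrt (dotp u u).
have nu0 : 0 < nu by rewrite sqrtr_gt0.
have nu2 : nu ^+ 2 = dotp u u by rewrite sqr_sqrtr // ltW.
have [N [c [c0 cN ce]]] := path_of_energy nu (s * nu) w0.
pose t x := dotp (x - m) w / dotp w w.
pose F x (i : 'I_N.+1) :=
  if i == 0 then dotp (x - m) u / nu else (1 - t x) * c i + t x * c i.-1.
have tE k z : t (m + k *: u + z *: w) = z.
  by rewrite /t -(addrA m) addrAC subrr add0r dotpDl !dotpZl uw mulr0 add0r mulfK // gt_eqF.
have F0 k z : F (m + k *: u + z *: w) 0 = k * nu.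
  rewrite /F eqxx -(addrA m) addrAC subrr add0r dotpDl !dotpZl (dotpC w) uw mulr0 addr0 -nu2.
  by field; rewrite gt_eqF.
apply: (@signed_orbit_embeddable _ _ (translations_group 'I_N.+1) (fun i => c i) _ _ F 1) => //.
- exact/abelian_sol/translations_abelian.
- move=> _ /XP[k [z [-> [[-> k1]|[-> ks]]]]].
    exists 1%g => [|i]; first exact: group1.
    rewrite perm1; case: (eqVneq i 0) => [->|i0].
      by rewrite F0 normrM k1 mul1r c0.
    by rewrite /F (negbTE i0) tE subr0 mul1r mul0r addr0.
  (* Adding [ord_max] subtracts 1 cyclically: 0 goes to [N], any other [i] to [i.-1]. *)
  exists (translation ord_max) => [|i]; first exact: imset_f.
  rewrite permE; case: (eqVneq i 0) => [->|i0].
    by rewrite F0 normrM ks -normrM addr0 -cN.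
  rewrite /F (negbTE i0) tE subrr mul0r add0r mul1r; congr `|c _|.
  move: i0; rewrite -val_eqE /=; case: i => -[|i] //= i_lt _.
  by rewrite addnS -addSn modnDl modn_small // ltnW.
- move=> _ _ /XP[k [z [-> _]]] /XP[k' [z' [-> _]]].
  set x := _ + _ + _; set y := _ + _ + _.
  rewrite mul1r big_ord_recl F0 F0 sqr_dist_dotp.
  have -> : x - y = (k - k') *: u + (z - z') *: w.
    by apply/rowP => i; rewrite !mxE; ring.
  rewrite !dotpDl !dotpDr !dotpZl !dotpZr (dotpC w) uw -nu2 -ce.
  have -> : \sum_(i < N) (F x (lift ord0 i) - F y (lift ord0 i)) ^+ 2 =
      (z - z') ^+ 2 * \sum_(i < N) (c i - c i.+1) ^+ 2.
    rewrite mulr_sumr; apply: eq_bigr => i _.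
    by rewrite /F /= !tE; ring.
  ring.
Qed.

Lemma isosceles_trapezium_embeddable (R : realType) n (A B C D : 'rV[R]_n) :
  isosceles_trapezium A B C D -> orbit_embeddable [fset A; B; C; D].
Proof.
move=> [_ [nABC _ _ _] [p [p0 DC]] BCDA rectP].
pose u := 2^-1 *: (B - A); pose m := 2^-1 *: (A + B).
pose w := 2^-1 *: (C + D) - m.
have EA : A = m - u by apply/rowP => i; rewrite !mxE; field.
have EB : B = m + u by apply/rowP => i; rewrite !mxE; field.
have ED : D = C + (2 * p) *: u.
  by apply/rowP => i; have /rowP/(_ i) := DC; rewrite !mxE => /(canRL (subrK _)) ->; field.
have EC : C = m + w - p *: u.
  by apply/rowP => i; rewrite /w ED !mxE; field.
have {}ED : D = m + w + p *: u.
  by apply/rowP => i; rewrite ED [in LHS]EC !mxE; ring.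
clearbody w m u.
have u0 : u != 0.
  apply/eqP => u0; apply: nABC; exists A, (C - A) => x; rewrite !inE.
  case/or3P => /eqP ->; first by exists 0; rewrite scale0r addr0.
    by exists 0; rewrite scale0r addr0 EA EB u0 subr0 addr0.
  by exists 1; rewrite scale1r addrC subrK.
have w0 : w != 0.
  apply/eqP => w0; apply: nABC; exists m, u => x; rewrite !inE.
  case/or3P => /eqP ->; first by exists (-1); rewrite scaleN1r.
    by exists 1; rewrite scale1r.
  by exists (- p); rewrite EC w0 addr0 scaleNr.
(* Equal legs give [(1 + p) * dotp u w = 0]. If [p = -1], the figure is a parallelogram, hence a
   rectangle, and its right angle at [A] gives the claim. *)
have uw : dotp u w = 0.
  have BC : B - C = (1 + p) *: u + (-1) *: w.
    by rewrite EB EC; apply/rowP => i; rewrite !mxE; ring.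
  have DA : D - A = (1 + p) *: u + w.
    by rewrite EA ED; apply/rowP => i; rewrite !mxE; ring.
  case: (eqVneq (1 + p) 0) => p1.
    have {}p1 : p = -1 by apply/eqP; rewrite -subr_eq0 opprK addrC p1.
    have [] := rectP.
      split; first by exists p.
      exists (-1); rewrite oppr_eq0 oner_neq0 -[A - D]opprB -[C - B]opprB BC DA p1.
      by split=> //; apply/rowP => i; rewrite !mxE; ring.
    rewrite /right_angle DA p1 subrr scale0r add0r => + _ _ _.
    have -> : B - A = 2 *: u by rewrite EA EB; apply/rowP => i; rewrite !mxE; ring.
    by rewrite dotpZr dotpC => /eqP; rewrite mulf_eq0 pnatr_eq0 /= => /eqP.
  have /= := congr1 (fun z => z ^+ 2) BCDA.
  rewrite !sqr_dist_dotp BC DA !dotpDl !dotpDr !dotpZl !dotpZr (dotpC w u) => h.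
  have : (1 + p) * dotp u w = 0 by lra.
  by move/eqP; rewrite mulf_eq0 (negbTE p1) => /eqP.
apply: (@symmetric_trapezium_embeddable _ _ m u w p) => // x.
rewrite !inE -!orbA => /or4P[] /eqP ->.
- exists (-1), 0; rewrite {1}EA scaleN1r scale0r addr0 normrN1; split=> //; by left.
- exists 1, 0; rewrite {1}EB scale1r scale0r addr0 normr1; split=> //; by left.
- exists (- p), 1; rewrite {1}EC scale1r scaleNr normrN addrAC; split=> //; by right.
- exists p, 1; rewrite {1}ED scale1r addrAC; split=> //; by right.
Qed.

(** * The dodecahedron and its ten axes *)

Section Diagonal.
Variable T : finType.

Lemma diag_inj (h : {perm T}) : injective (fun t : T * T => (h t.1, h t.2)).
Proof. by move=> [a b] [c d] [/perm_inj-> /perm_inj->]. Qed.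

Definition diag_perm h := perm (@diag_inj h).

Lemma diag_permM : {in [set: {perm T}]%SET &, {morph diag_perm : g h / (g * h)%g}}.
Proof.
move=> g h _ _; apply/permP => t.
by rewrite permM [LHS]permE !permM ![diag_perm _ _]permE.
Qed.

Canonical diag_morphism := Morphism diag_permM.

End Diagonal.

Section Dodecahedron.
Variable R : realType.
Local Notation phi := (golden R).

Lemma sqr_golden : phi * phi = phi + 1.
Proof.
have s5 : Num.sqrt 5 * Num.sqrt 5 = 5 :> R by rewrite -expr2 sqr_sqrtr ?ler0n.
rewrite /golden; set s := Num.sqrt 5 in s5 *.
have -> : (1 + s) / 2 * ((1 + s) / 2) = (1 + 2 * s + s * s) / 4 by field.
by rewrite s5; field.
Qed.

Lemma golden_gt1 : 1 < phi.
Proof.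
have : 1 < Num.sqrt 5 :> R by rewrite -[ltLHS]sqrtr1 ltr_sqrt ?ltr0n // ltr1n.
by rewrite /golden => s; lra.
Qed.

Lemma golden_inv : phi^-1 = phi - 1.
Proof.
have g0 : phi != 0 by rewrite gt_eqF // (lt_trans ltr01 golden_gt1).
by apply: (mulfI g0); rewrite mulfV // mulrBr mulr1 sqr_golden; ring.
Qed.

(* Label the five cubes inscribed in the dodecahedron by 0, ..., 4: each of the
   ten axes through opposite vertices is a diagonal of exactly two of them.  The
   default case makes the axis zero when k = l. *)
Definition vertex_axis (k l : nat) : seq R :=
  let p := phi - 1 in
  match k, l with
  | 0, 1 => [:: 1; 1; 1]%R
  | 0, 2 => [:: 1; -1; -1]%R
  | 0, 3 => [:: -1; 1; -1]%R
  | 0, 4 => [:: -1; -1; 1]%R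
  | 1, 2 => [:: 0; p; - phi]%R
  | 3, 4 => [:: 0; p; phi]%R
  | 1, 3 => [:: phi; 0; - p]%R
  | 2, 4 => [:: phi; 0; p]%R
  | 1, 4 => [:: p; - phi; 0]%R
  | 2, 3 => [:: p; phi; 0]%R
  | _, _ => [::]%R
  end%N.

(** Symmetric in [k] and [l], so that permutations of the labels act on ordered pairs; each axis is
    then counted twice. *)
Definition axis_coord (x : seq R) (k l : nat) : R :=
  let u := if (k <= l)%N then vertex_axis k l else vertex_axis l k in
  x`_0 * u`_0 + x`_1 * u`_1 + x`_2 * u`_2.

(** The absolute scalar product of two axes with 0, 1 or 2 common labels: the square root of 5,
    which is [2 * phi - 1], then 1, then the squared length 3. *)
Definition axis_angle (T : eqType) (k l k' l' : T) : R :=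
  if k' == l' then 0 else
  [:: 2 * phi - 1; 1; 3]`_((k' \in [:: k; l]) + (l' \in [:: k; l])).

Lemma norm_eq_pm (e c : R) : 0 <= c -> e = c \/ e = - c -> `|e| = c.
Proof. by move=> c0 [] ->; rewrite ?normrN ger0_norm. Qed.

Lemma axis_coord_axis k l k' l' :
  (k < l)%N -> (l < 5)%N -> (k' < 5)%N -> (l' < 5)%N ->
  `|axis_coord (vertex_axis k l) k' l'| = axis_angle k l k' l'.
Proof.
have g2 := sqr_golden; have g1 := golden_gt1; move: g2 g1.
rewrite /axis_coord /axis_angle /vertex_axis; move: phi => g g2 g1.
move: k l => [|[|[|[|[|k]]]]] [|[|[|[|[|l]]]]] // _ _;
move: k' => [|[|[|[|[|k']]]]] // _;
move: l' => [|[|[|[|[|l']]]]] // _;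
(* Each case is linear in [g] and [g * g], up to the choice of a sign. *)
apply: norm_eq_pm; rewrite /=; try lra; by first [left; lra | right; lra].
Qed.

Lemma sum_F5 (f : nat -> R) : \sum_(i : 'F_5) f i = f 0 + f 1 + f 2 + f 3 + f 4.
Proof.
by rewrite -[LHS]/(\sum_(i < 5) f i) !big_ord_recr big_ord0 /= add0r.
Qed.

(** The ten axes form a tight frame with constant 10, doubled by the ordered pairs. *)
Lemma sum_axis_coord (x : seq R) :
  \sum_(k : 'F_5) \sum_(l : 'F_5) axis_coord x k l ^+ 2 =
  20 * (x`_0 ^+ 2 + x`_1 ^+ 2 + x`_2 ^+ 2).
Proof.
pose S := x`_0 ^+ 2 + x`_1 ^+ 2 + x`_2 ^+ 2.
(* With [phi] as an indeterminate the two sides differ by a multiple of [phi * phi - (phi + 1)];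
   this makes the identity provable by [ring]. *)
transitivity (20 * S + 8 * S * (phi * phi - (phi + 1))); last first.
  by rewrite sqr_golden subrr mulr0 addr0.
pose f k l := axis_coord x k l ^+ 2.
under eq_bigr do rewrite (sum_F5 (f _)).
rewrite (sum_F5 (fun k => f k 0%N + f k 1%N + f k 2%N + f k 3%N + f k 4%N)) /S /f.
by rewrite /axis_coord /=; ring.
Qed.

Ltac try_axis k l s :=
  exists k, l, s; split; [by []|by []|split; rewrite /= ?expr0 ?expr1; lra].

Ltac find_axis :=
  let go k l := first [try_axis k l false | try_axis k l true] in
  first [go 0%N 1%N | go 0%N 2%N | go 0%N 3%N | go 0%N 4%N | go 1%N 2%N
       | go 1%N 3%N | go 1%N 4%N | go 2%N 3%N | go 2%N 4%N | go 3%N 4%N].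

Lemma dodecahedron_vertexP (x : 'rV[R]_3) : x \in dodecahedron_vertices R ->
  exists k l (s : bool), [/\ (k < l)%N, (l < 5)%N
    & forall i : 'I_3, x 0 i = (-1) ^+ s * (vertex_axis k l)`_i].
Proof.
(* Reduces the claim to three explicit entries, on which all axes and signs can be tried. *)
have search (y : 'rV[R]_3) a b c : y 0 0 = a -> y 0 1 = b -> y 0 (1 + 1) = c ->
    (exists k l (s : bool), [/\ (k < l)%N, (l < 5)%N
     & [/\ a = (-1) ^+ s * (vertex_axis k l)`_0, b = (-1) ^+ s * (vertex_axis k l)`_1
         & c = (-1) ^+ s * (vertex_axis k l)`_2]]) ->
    exists k l (s : bool), [/\ (k < l)%N, (l < 5)%N
      & forall i : 'I_3, y 0 i = (-1) ^+ s * (vertex_axis k l)`_i].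
  move=> ya yb yc [k [l [s [kl l5 [ea eb ec]]]]]; exists k, l, s; split=> //.
  case=> -[|[|[|//]]] i3 /=.
  - by rewrite -ea -ya; congr (y 0 _); exact/val_inj.
  - by rewrite -eb -yb; congr (y 0 _); exact/val_inj.
  - by rewrite -ec -yc; congr (y 0 _); exact/val_inj.
rewrite inE => /orP[] /imfset2P[p /= p_even [e _ ->]].
  apply: (search _ ((-1) ^+ e 0) ((-1) ^+ e 1) ((-1) ^+ e (1 + 1))).
  - by rewrite !mxE; case: (p _) => -[|[|[|//]]] ? /=; rewrite mulr1.
  - by rewrite !mxE; case: (p _) => -[|[|[|//]]] ? /=; rewrite mulr1.
  - by rewrite !mxE; case: (p _) => -[|[|[|//]]] ? /=; rewrite mulr1.
  case: (e 0); case: (e 1); case: (e (1 + 1)); find_axis.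
move: p_even; rewrite inE => /even_perm3[a ->].
have pE (j : 'I_3) :
    (\row_i ((-1) ^+ e i *
             row_of_seq 3 [:: 0; phi^-1; phi] 0 (translation a i))) 0 j =
    (-1) ^+ e j * [:: 0; phi - 1; phi]`_(a + j)%R.
  by rewrite !mxE permE golden_inv.
apply: (search _ _ _ _ (pE 0) (pE 1) (pE (1 + 1))).
case: a {pE} => -[|[|[|//]]] ?; case: (e 0); case: (e 1); case: (e (1 + 1));
  find_axis.
Qed.

Lemma axis_angle_inj (T U : eqType) (f : T -> U) k l a b : injective f ->
  axis_angle (f k) (f l) (f a) (f b) = axis_angle k l a b.
Proof. by move=> fI; rewrite /axis_angle !inE !(inj_eq fI). Qed.

Lemma dodecahedron_embeddable : orbit_embeddable (dodecahedron_vertices R).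
Proof.
pose coords (x : 'rV[R]_3) :=
  [:: x 0 ord0; x 0 (lift ord0 ord0); x 0 (lift ord0 (lift ord0 ord0))].
pose F x (t : 'F_5 * 'F_5) := axis_coord (coords x) t.1 t.2.
pose v (t : 'F_5 * 'F_5) := axis_angle 0 1 t.1 t.2.
apply: (@signed_orbit_embeddable _ _ (diag_morphism 'F_5 @* affine_group 'F_5)%G v _ _ F 20).
- by rewrite ltr0n.
- exact/morphim_sol/affine_solvable.
- move=> x /dodecahedron_vertexP[k [l [s [kl l5 xkl]]]].
  have k5 : (k < 5)%N := ltn_trans kl l5.
  pose k' : 'F_5 := Ordinal k5; pose l' : 'F_5 := Ordinal l5.
  have kl' : k' != l' by rewrite -val_eqE /= ltn_eqF.
  (* [axis_angle] sees only coincidences of labels, so moving [(k, l)] to [(0, 1)] by [h] matches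
     [F x] with [v] up to signs. *)
  have [h Hh [hk hl]] := affine_2transitive kl' (isT : (0 : 'F_5) != 1).
  exists (diag_perm h); first by apply: mem_morphim => //; rewrite inE.
  move=> [a b]; rewrite permE /v /= -hk -hl /F /=.
  have -> : axis_coord (coords x) a b = (-1) ^+ s * axis_coord (vertex_axis k l) a b.
    by rewrite /axis_coord /= !xkl /=; ring.
  rewrite normrM normr_sign mul1r axis_coord_axis //; try exact: ltn_ord.
  rewrite axis_angle_inj; last exact: perm_inj.
  rewrite -(axis_angle_inj k' l' a b val_inj) ger0_norm // /axis_angle.
  case: ifP => // _; have g1 := golden_gt1; move: (_ + _)%N => [|[|[|n]]] /=; try lra.
  by rewrite nth_nil.
- move=> x y _ _; rewrite sqr_dist !big_ord_recl big_ord0 addr0 addrA.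
  rewrite -(pair_bigA _ (fun k l => (F x (k, l) - F y (k, l)) ^+ 2)) /=.
  pose z := [seq t.1 - t.2 | t <- zip (coords x) (coords y)].
  rewrite -[RHS](sum_axis_coord z); apply: eq_bigr => k _; apply: eq_bigr => l _.
  by congr (_ ^+ 2); rewrite /F /axis_coord /=; ring.
Qed.

End Dodecahedron.

Theorem theorem1p5 (R : realType) :
  [/\ forall (a b c : R) (i j : nat),
        subsoluble
          (coord_perms (row_mx (row_mx (const_mx a : 'rV[R]_i)
                                       (const_mx b : 'rV[R]_j))
                               (const_mx c : 'rV[R]_1))),
      forall (P : regular_polytope) (n : nat) (X : {fset 'rV[R]_n}),
        P <> Cell120 -> P <> Cell600 -> is_vertex_set P X -> subsoluble X
    & forall (n : nat) (A B C D : 'rV[R]_n),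
        isosceles_trapezium A B C D -> subsoluble [fset A; B; C; D]].
Proof.
split=> [a b c i j|P n X P120 P600 [c [f [c0 fdist ->]]]|n A B C D trapABCD].
- exact/orbit_embeddable_subsoluble/coord_perms_embeddable.
(* Size and position are absorbed here once for all types; only the models remain. *)
- apply: (orbit_embeddable_similar (ltW c0) fdist) => //.
  case: P P120 P600 {f fdist} => [k k3|d d3|d d3|d d3|||| |] //= _ _.
  + exact: polygon_embeddable.
  + exact: simplex_embeddable.
  + by apply: cube_embeddable; apply: leq_trans d3.
  + exact: orthoplex_embeddable.
  + exact: dodecahedron_embeddable.
  + exact: icosahedron_embeddable.
  + exact: cell24_embeddable.
- exact/orbit_embeddable_subsoluble/isosceles_trapezium_embeddable.
Qed.
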